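(* Let $X$ be a non-empty completely regular Hausdorff space. The following statements are equivalent. (a) $X$ is an extremally disconnected space. (b) $X$ is both an EF-space and an EZ-space. (c) $X$ is an $F_{\alpha}$-space in the sense of Swardson for each infinite cardinal $\alpha$. (d) $X$ is an $F_{\alpha}$-space in the sense of Comfort and Negrepontis for each infinite cardinal $\alpha$. (e) The closure of any union of clopen subsets of $X$ is open and $X$ is an EZ-space.
   Context: A space is extremally disconnected if the closure of every open subset is open. A subset $S$ of $X$ is $C^{*}$-embedded in $X$ if every bounded continuous real-valued function on $S$ extends to a bounded continuous real-valued function on $X$. Two subsets $A,B$ of $X$ are completely separated if there is a continuous $f:X\to[0,1]$ with $f=0$ on $A$ and $f=1$ on $B$. EF-space: for any two collections $\mathcal{U},\mathcal{V}$ of clopen subsets of $X$ with $\bigcup\mathcal{U}\cap\bigcup\mathcal{V}=\emptyset$, the sets $\bigcup\mathcal{U}$ and $\bigcup\mathcal{V}$ are completely separated in $X$. EZ-space: for every open subset $A$ of $X$ there is a collection of clopen subsets of $X$ whose union has the same closure as $A$. Swardson's definition: an $\alpha$-open set is a set of the form $\bigcup\mathcal{U}$ where $\mathcal{U}$ is a collection of cozero-sets of $X$ with $|\mathcal{U}|<\alpha$; an $F_\alpha$-space is a Tychonoff space in which every $\alpha$-open subset is $C^{*}$-embedded. Comfort–Negrepontis' definition: an open set is of type $<\alpha$ if it is the union of fewer than $\alpha$ clopen subsets of $X$; an $F_\alpha$-space is a zero-dimensional space in which every open subset of type $<\alpha$ is $C^{*}$-embedded in $X$. A space is zero-dimensional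 if it is a non-empty $T_1$-space with a base consisting of clopen sets. *)

(* Defs.v *)
From HB Require Import structures.
From mathcomp Require Import all_boot all_order all_algebra.
From mathcomp Require Import all_classical all_reals all_analysis.

Set Implicit Arguments.
Unset Strict Implicit.
Unset Printing Implicit Defensive.

Import Order.TTheory GRing.Theory Num.Theory.
Import numFieldNormedType.Exports.
Local Open Scope classical_set_scope.
Local Open Scope ring_scope.
Local Open Scope card_scope.

(* A cardinal is represented by a set [alpha : set K] of that cardinality, over
   an arbitrary type [K]; it is infinite when [infinite_set alpha]. *)
Definition card_lt (T K : Type) (A : set T) (alpha : set K) : Prop :=
  A #<= alpha /\ ~ (alpha #<= A).

Definition extremally_disconnected (X : topologicalType) : Prop :=
  forall A : set X, open A -> open (closure A).

(* [{within S, continuous f}] is continuity of the restriction of [f] to the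
   subspace [S]; the values of [f] outside [S] are irrelevant, so [f] stands
   for an arbitrary function on [S]. *)
Definition Cstar_embedded (R : realType) (X : topologicalType) (S : set X) :
    Prop :=
  forall f : X -> R, {within S, continuous f} -> [bounded f x | x in S] ->
  exists g : X -> R, [/\ continuous g, [bounded g x | x in [set: X]] &
                         forall x, S x -> g x = f x].

Definition completely_separated (R : realType) (X : topologicalType)
    (A B : set X) : Prop :=
  exists f : X -> R, [/\ continuous f, range f `<=` `[0, 1],
    forall x, A x -> f x = 0 & forall x, B x -> f x = 1].

Definition EF_space (R : realType) (X : topologicalType) : Prop :=
  forall U V : set (set X), U `<=` clopen -> V `<=` clopen ->
  (\bigcup_(A in U) A) `&` (\bigcup_(B in V) B) = set0 ->
  completely_separated R (\bigcup_(A in U) A) (\bigcup_(B in V) B).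

Definition EZ_space (X : topologicalType) : Prop :=
  forall A : set X, open A ->
  exists2 U : set (set X),
    U `<=` clopen & closure (\bigcup_(B in U) B) = closure A.

Definition cozero_set (R : realType) (X : topologicalType) (A : set X) : Prop :=
  exists2 f : X -> R, continuous f & A = [set x | f x != 0].

Definition tychonoff_space (X : topologicalType) : Prop :=
  completely_regular_space X /\ hausdorff_space X.

Definition alpha_open (R : realType) (X : topologicalType) (K : Type)
    (alpha : set K) (A : set X) : Prop :=
  exists U : set (set X), [/\ U `<=` @cozero_set R X, card_lt U alpha &
                              A = \bigcup_(B in U) B].

Definition Swardson_F_space (R : realType) (X : topologicalType) (K : Type)
    (alpha : set K) : Prop :=
  tychonoff_space X /\
  forall A : set X, alpha_open R alpha A -> Cstar_embedded R A.

(* Not the library's [zero_dimensional], which only asks that distinct points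
   be separated by a clopen set. *)
Definition zero_dimensional_space (X : topologicalType) : Prop :=
  [/\ [set: X] !=set0, @accessible_space X &
      exists2 B : set (set X), basis B & B `<=` clopen].

Definition open_of_type_lt (X : topologicalType) (K : Type)
    (alpha : set K) (A : set X) : Prop :=
  exists U : set (set X), [/\ U `<=` clopen, card_lt U alpha &
                              A = \bigcup_(B in U) B].

Definition CN_F_space (R : realType) (X : topologicalType) (K : Type)
    (alpha : set K) : Prop :=
  zero_dimensional_space X /\
  forall A : set X, open_of_type_lt alpha A -> Cstar_embedded R A.

(* Main.v *)
Require Import Defs.
From HB Require Import structures.
From mathcomp Require Import all_boot all_order all_algebra.
From mathcomp Require Import all_classical all_reals all_analysis.
Import numFieldNormedType.Exports.
Local Open Scope classical_set_scope.
Local Open Scope ring_scope.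
Import Order.TTheory GRing.Theory Num.Theory.

(** If an open [S] of an extremally disconnected space carries a bounded
    continuous [f], the closures of the sets [{x in S | f x < r}] form an
    increasing family of clopen sets, and [x |-> inf {r | x in closure {f < r}}]
    extends [f].  Conversely, if [A] is open and [B] is the complement of its
    closure, then [A `|` B] is open and dense; a continuous extension of the
    function equal to [0] on [A] and [1] on [B] takes no other value, and this
    makes [closure A] open.  For large [alpha], every open set is a union of
    fewer than [alpha] basic (cozero or clopen) sets. *)

(** * Separation of sets by continuous real functions *)

Section Separation.
Context {R : realType} {X : topologicalType}.
Implicit Types (A B : set X) (f : X -> R).

Lemma closure_sub_fiber {A f} {c : R} : continuous f ->
  (forall x, A x -> f x = c) -> forall x, closure A x -> f x = c.
Proof.
move=> cf fA; have cl : closed (f @^-1` [set c]).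
  by move/continuous_closedP: cf; apply; exact: closed_eq.
move=> x /(closure_subset (B := f @^-1` [set c]) fA).
by rewrite -(closure_id _).1.
Qed.

(** Fibers of [f] are closed, so [f] is 0 on [closure A] and 1 on [closure B]; as these closures
    cover [X], the first is exactly the open set where [f < 1]. *)
Lemma open_closure_separated {A B f} : continuous f ->
  (forall x, A x -> f x = 0) -> (forall x, B x -> f x = 1) ->
  (forall x, closure A x \/ closure B x) -> open (closure A).
Proof.
move=> cf fA fB AB.
suff -> : closure A = f @^-1` [set y | y < 1].
  by apply: open_comp; [move=> x _; exact: cf|exact: open_lt].
apply/seteqP; split => x /=.
  by move=> /(closure_sub_fiber cf fA) ->.
by case: (AB x) => // /(closure_sub_fiber cf fB) ->; rewrite ltxx.
Qed.

Lemma open_disjoint_closure {A B} : open B -> A `&` B = set0 ->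
  closure A `&` B = set0.
Proof.
move=> oB AB; apply/seteqP; split => // x [clA Bx].
by have [y] := clA _ (open_nbhs_nbhs (conj oB Bx)); rewrite AB.
Qed.

Lemma clopen_indic_continuous {A} : clopen A -> continuous (\1_A : X -> R).
Proof.
move=> [oA cA] x; have [Ax|nAx] := pselect (A x).
  apply: cvg_near_cst; near=> y.
  have Ay : A y by near: y; exact: open_nbhs_nbhs.
  by rewrite !indicE !mem_set.
apply: cvg_near_cst; near=> y.
have nAy : ~ A y.
  by near: y; apply: (@open_nbhs_nbhs _ x (~` A)); split => //; rewrite openC.
by rewrite !indicE !memNset.
Unshelve. all: by end_near. Qed.

Lemma clopen_cozero {A} : clopen A -> cozero_set R A.
Proof.
move=> cA; exists (\1_A); first exact: clopen_indic_continuous.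
apply/seteqP; split=> x /=; rewrite indicE.
  by move=> Ax; rewrite mem_set// oner_neq0.
by apply: contraNP => nAx; rewrite memNset.
Qed.

Lemma Cstar_embedded_open_closure {A} : open A ->
  Cstar_embedded R (A `|` ~` closure A) -> open (closure A).
Proof.
move=> oA CA.
have oB : open (~` closure A) by rewrite openC; exact: closed_closure.
(* On the union this indicator is locally constant, each of the two disjoint pieces being open. *)
have [||g [cg _ gf]] := CA (\1_(~` closure A)).
- rewrite continuous_open_subspace; last exact: openU.
  move=> x /set_mem[Ax|Bx]; apply: cvg_near_cst; near=> y.
    have Ay : A y by near: y; exact: open_nbhs_nbhs.
    by rewrite !indicE !memNset// => /(_ (subset_closure _)); exact.
  have By : (~` closure A) y by near: y; exact: open_nbhs_nbhs.
  by rewrite !indicE !mem_set.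
- exists 1; split; first exact: num_real.
  move=> M M1 x _ /=; rewrite indicE; apply: le_trans (ltW M1).
  by case: (_ \in _); rewrite ?normr0 ?normr1.
apply: (open_closure_separated (B := ~` closure A) cg).
- move=> x Ax; rewrite gf; last by left.
  by rewrite indicE memNset// => /(_ (subset_closure Ax)).
- by move=> x Bx; rewrite gf; [rewrite indicE mem_set|right].
- by move=> x; have [|] := pselect (closure A x); [left|right; exact: subset_closure].
Unshelve. all: by end_near. Qed.

End Separation.

(** * Extension of bounded functions from open sets *)

Section Extension.
Context {R : realType} {X : topologicalType}.

Lemma ED_Cstar_embedded {S : set X} :
  extremally_disconnected X -> open S -> Cstar_embedded R S.
Proof.
move=> ED oS f cf [M0 [_ fM0]].
(* Boundedness gives the estimate only for constants strictly above [M0], hence [M0 + 1]; the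
   maximum with 1 makes [M] positive. *)
pose M := Num.max (M0 + 1) 1.
have M_gt0 : 0 < M by rewrite lt_max ltr01 orbT.
have fM x : S x -> `|f x| <= M.
  by apply: fM0; rewrite lt_max ltrDl ltr01.
have {}cf : {in S, continuous f} by rewrite -continuous_open_subspace.
have oSf (D : set R) : open D -> open [set x | S x /\ D (f x)].
  move=> oD; rewrite openE => x [Sx Dx]; apply: filterI.
    exact: open_nbhs_nbhs.
  exact: (cf x (mem_set Sx) D (open_nbhs_nbhs (conj oD Dx))).
(* The second summand is the whole space once [M < r]: every point then lies in some [T r], and off
   [closure S] the infimum taken below is [M]. *)
pose T r : set X := closure [set x | S x /\ f x < r] `|` [set _ | M < r].
have Tmono r s : r <= s -> T r `<=` T s.
  move=> rs x [clx|/= Mr]; [left|right; exact: lt_le_trans rs].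
  by apply: closure_subset clx => y [Sy fy]; split=> //; exact: lt_le_trans rs.
have Tlb r x : T r x -> - M <= r.
  case=> [clx|/= Mr].
    have [y [[Sy fyr] _]] := clx _ filterT.
    by apply: le_trans (ltW fyr); have := fM _ Sy; rewrite ler_norml => /andP[].
  by apply: le_trans (ltW Mr); rewrite ge0_cp// ltW.
have MT x : T (M + 1) x by right; rewrite /= ltrDl.
have oMr r : clopen [set _ : X | M < r].
  have [Mr|nMr] := pselect (M < r).
    suff -> : [set _ : X | M < r] = setT by exact: clopenT.
    by apply/seteqP; split.
  suff -> : [set _ : X | M < r] = set0 by exact: clopen0.
  by apply/seteqP; split.
have oT r : open (T r).
  (* Extremal disconnectedness enters here and makes each [T r] clopen. *)
  by apply: openU (oMr r).1; apply: ED; apply: (oSf [set y | y < r]); exact: open_lt.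
have cT r : closed (T r) by apply: closedU (oMr r).2; exact: closed_closure.
pose g x := inf [set r | T r x].
have g_le r x : T r x -> g x <= r.
  by move=> Trx; apply: ge_inf => //; exists (- M) => s /Tlb.
have g_ge r x : ~ T r x -> r <= g x.
  move=> nT; apply: lb_le_inf; first by exists (M + 1); exact: MT.
  by move=> s Ts; rewrite leNgt; apply/negP => /ltW /Tmono /(_ _ Ts).
have gT r x : g x < r -> T r x.
  by move=> gr; apply: contrapT => /g_ge; rewrite leNgt gr.
have gnT r x : r < g x -> ~ T r x by move=> gr /g_le; rewrite leNgt gr.
exists g; split.
(* The neighbourhood of [x] is [T (g x + e)] minus [T (g x - e)], open because each [T r] is
   clopen. *)
- move=> x; apply/cvgrPdist_le => e e0; near=> y.
  rewrite ler_distlC; apply/andP; split.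
    apply: g_ge; near: y; apply: (@open_nbhs_nbhs _ x (~` T _)).
    by split; [rewrite openC|apply: gnT; rewrite ltrBlDr ltrDl].
  apply: g_le; near: y; apply: open_nbhs_nbhs; split=> //.
  by apply: gT; rewrite ltrDl.
- exists (M + 1); split; first exact: num_real.
  move=> N MN x _; apply: le_trans (ltW MN); rewrite ler_norml g_le// andbT.
  by apply: g_ge => /Tlb; rewrite lerN2 leNgt ltrDl ltr01.
- move=> x Sx; apply/eqP; rewrite eq_le; apply/andP; split.
    apply/ler_addgt0Pr => e e0; apply: g_le; left; apply: subset_closure.
    by split=> //; rewrite ltrDl.
  (* The point [x] is not in [T (f x - e)]: the open set where [f > f x - e] contains [x] and misses
     the set where [f < f x - e], while [M < f x - e] contradicts the bound. *)
  apply/ler_addgt0Pr => e e0; rewrite -lerBlDr; apply: g_ge => -[clx|/=].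
    have ox : open [set y | S y /\ f x - e < f y].
      by apply: (oSf [set y | f x - e < y]); exact: open_gt.
    have [] := clx _ (open_nbhs_nbhs (conj ox _)).
      by split=> //; rewrite ltrBlDr ltrDl.
    by move=> y [[_ fy] [_]]; rewrite ltNge ltW.
  apply/negP; rewrite -leNgt; apply: le_trans (le_trans (ler_norm _) (fM _ Sx)).
  by rewrite lerBlDr lerDl ltW.
Unshelve. all: by end_near. Qed.

End Extension.

(** * Cardinals exceeding a given family *)

Lemma set_inj_cantor {T : Type} (h : set T -> T) : ~ injective h.
Proof.
(* Diagonal set: by injectivity, [h D] lies in [D] only if it does not. *)
move=> hI; pose D := [set y | exists2 A, y = h A & ~ A y].
have nD : ~ D (h D) by move=> /[dup] DhD [A /hI <-].
by apply: (nD); exists D.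
Qed.

(* The summand [nat] is there to make the cardinal infinite. *)
Lemma card_lt_large {T : Type} (U : set T) : card_lt U [set: set (T + nat)].
Proof.
split.
  apply/pcard_injP; exists (fun x => [set inl x]) => x y _ _ /= xy.
  have : [set inl y] (inl x : T + nat) by rewrite -xy.
  by case.
move=> /card_leP[f].
(* An injection of the subsets of [T + nat] into [U], followed by [inl], would land in [T + nat]. *)
apply: (@set_inj_cantor (T + nat) (fun A => inl (val (f (SigSub (mem_setT A)))))).
move=> A B [] /val_inj.
by move/(@inj _ _ _ f) => /(_ (mem_setT _) (mem_setT _)) [].
Qed.

Lemma infinite_large (T : Type) : infinite_set [set: set (T + nat)].
Proof.
apply/infiniteP/pcard_injP; exists (fun n => [set inr n]) => m n _ _ /= mn.
have : [set inr n] (inr m : T + nat) by rewrite -mn.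
by case.
Qed.

(** * The cycle of implications *)

Theorem corollary3p11 (R : realType) (X : topologicalType)
    (X_nonempty : [set: X] !=set0)
    (X_completely_regular : completely_regular_space X)
    (X_hausdorff : hausdorff_space X) :
  [<-> extremally_disconnected X;
       EF_space R X /\ EZ_space X;
       forall (K : Type) (alpha : set K),
         infinite_set alpha -> Swardson_F_space R X alpha;
       forall (K : Type) (alpha : set K),
         infinite_set alpha -> CN_F_space R X alpha;
       (forall U : set (set X), U `<=` clopen ->
          open (closure (\bigcup_(A in U) A))) /\ EZ_space X].
Proof.
have ED_of_Cstar : (forall A : set X, open A -> Cstar_embedded R A) ->
    extremally_disconnected X.
  move=> CX A oA; apply: (Cstar_embedded_open_closure (R := R)) => //.
  by apply: CX; apply: openU => //; rewrite openC; exact: closed_closure.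
tfae.
- move=> ED; split.
    move=> U V Ucl Vcl UV0.
    have oU : open (\bigcup_(A in U) A) by apply: bigcup_open => A /Ucl[].
    have oV : open (\bigcup_(A in V) A) by apply: bigcup_open => A /Vcl[].
    have cUV := open_disjoint_closure oV UV0.
    have cU : clopen (~` closure (\bigcup_(A in U) A)).
      split; first by rewrite openC; exact: closed_closure.
      by rewrite closedC; exact: ED.
    exists (\1_(~` closure (\bigcup_(A in U) A))); split.
    + exact: clopen_indic_continuous.
    + move=> _ [x _ <-] /=; rewrite in_itv/= indicE.
      by case: (_ \in _); rewrite ?lexx ler01.
    + by move=> x Ux; rewrite indicE memNset// => /(_ (subset_closure Ux)).
    + move=> x Vx; rewrite indicE mem_set// => clx.
      by have : set0 x by rewrite -cUV.
  move=> A oA; exists [set closure A].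
    by move=> _ ->; split; [exact: ED|exact: closed_closure].
  by rewrite bigcup_set1 -(closure_id _).1//; exact: closed_closure.
- move=> [EF EZ].
  have ED : extremally_disconnected X.
    move=> A oA; have [U Ucl UA] := EZ A oA.
    have oB : open (~` closure A) by rewrite openC; exact: closed_closure.
    have [V Vcl VB] := EZ _ oB.
    have oU : open (\bigcup_(A in U) A) by apply: bigcup_open => C /Ucl[].
    have UB0 : (~` closure A) `&` (\bigcup_(A in U) A) = set0.
      rewrite -subset0 => x [Bx Ux]; apply: Bx; rewrite -UA.
      exact: subset_closure.
    (* The union of [U] is open and misses the complement of [closure A], hence also the closure of
       that complement, which contains the union of [V]. *)
    have [|f [cf _ f0 f1]] := EF U V Ucl Vcl.
      rewrite -subset0 => x [Ux Vx].
      rewrite -(open_disjoint_closure oU UB0); split => //.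
      by rewrite -VB; exact: subset_closure.
    rewrite -UA; apply: (open_closure_separated cf f0 f1) => x.
    rewrite UA VB.
    by have [|] := pselect (closure A x); [left|right; exact: subset_closure].
  move=> K alpha _; split=> // A [U [Ucz _ ->]].
  apply: ED_Cstar_embedded => //; apply: bigcup_open => B /Ucz [f cf ->].
  by move/continuousP: cf => /(_ _ (open_neq (y := 0))).
- move=> SX.
  have ED : extremally_disconnected X.
    apply: ED_of_Cstar => A oA.
    (* This cardinal exceeds every family of subsets of [X], so all cozero sets inside [A] may be
       used at once. *)
    have [_] := SX _ _ (infinite_large (set X)); apply.
    exists [set B | cozero_set R B /\ B `<=` A]; split.
    + by move=> B [].
    + exact: card_lt_large.
    + apply/seteqP; split => [x Ax|x [B [_ BA] /BA//]].
      have /(uniform_separatorP (R := R)) [f [cf _ fx fA]] :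
          uniform_separator [set x] (~` A).
        by apply: X_completely_regular; [rewrite closedC|].
      (* As [f] is 0 at [x] and 1 off [A], the function [f - 1] vanishes off [A] but not at [x]. *)
      exists [set y | f y - 1 != 0] => /=.
        split; first exists (fun y => f y - 1) => //.
          by move=> y; apply: cvgB; [exact: cf|exact: cvg_cst].
        move=> y /= fy; apply: contrapT => nAy.
        have /fA /= : (f @` (~` A)) (f y) by exists y.
        by move=> fy1; move: fy; rewrite fy1 subrr eqxx.
      have /fx /= -> : (f @` [set x]) (f x) by exists x.
      by rewrite sub0r oppr_eq0 oner_neq0.
  move=> K alpha alpha_inf; have [_ Salpha] := SX _ _ alpha_inf; split.
    split=> //; first exact: hausdorff_accessible.
    exists clopen => //; split; first by move=> A [].
    move=> x A /(completely_regular_regular (R := R) X_completely_regular).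
    (* Regularity shrinks [A] to a closed neighbourhood; the closure of its interior is clopen by
       [ED]. *)
    move=> [B xB clBA]; exists (closure B^°).
      split; last by apply: subset_closure; exact: nbhs_singleton (nbhs_interior xB).
      by split; [apply: ED; exact: open_interior|exact: closed_closure].
    apply: subset_trans clBA; apply: closure_subset; exact: interior_subset.
  move=> A [U [Ucl Ualpha ->]]; apply: Salpha; exists U; split=> // B /Ucl.
  exact: clopen_cozero.
- move=> CN.
  (* One large cardinal yields both the clopen base and embedding for unions of arbitrarily many of
     its members. *)
  have [[_ _ [B [Bo Bx] Bcl]] CNX] := CN _ _ (infinite_large (set X)).
  have basisE (A : set X) : open A -> A = \bigcup_(C in [set C | B C /\ C `<=` A]) C.
    move=> oA; apply/seteqP; split => [x Ax|x [C [_ CA] /CA//]].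
    have [C [BC Cx] CA] := Bx x A (open_nbhs_nbhs (conj oA Ax)).
    by exists C.
  have ED : extremally_disconnected X.
    apply: ED_of_Cstar => A oA; apply: CNX.
    exists [set C | B C /\ C `<=` A]; split; last exact: basisE.
    + by move=> C [/Bcl].
    + exact: card_lt_large.
  split; first by move=> U Ucl; apply: ED; apply: bigcup_open => C /Ucl[].
  move=> A oA; exists [set C | B C /\ C `<=` A]; first by move=> C [/Bcl].
  by rewrite -basisE.
- by move=> [cl_open EZ] A /EZ [U Ucl <-]; exact: cl_open.
Qed.
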